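(* Let $n$ be a positive integer. The monoid $\mathrm{wEnd}\,\vec{P}_n$ has exactly $\frac{1}{2}(n+n^2)$ idempotents.
   Context: $\vec{P}_n$ denotes the directed path with vertex set $\{1,\ldots,n\}$ and edge set $E=\{(i,i+1) : i=1,\ldots,n-1\}$. A weak endomorphism of $\vec{P}_n$ is a map $\alpha:\{1,\ldots,n\}\to\{1,\ldots,n\}$ such that, for all vertices $u,v$, if $(u,v)\in E$ and $u\alpha\neq v\alpha$ then $(u\alpha,v\alpha)\in E$ (maps are written on the right of their arguments). $\mathrm{wEnd}\,\vec{P}_n$ denotes the monoid of all weak endomorphisms of $\vec{P}_n$ under composition of maps. An idempotent is an element $\alpha$ with $\alpha^2=\alpha$. *)

(* Defs.v *)
From HB Require Import structures.
From mathcomp Require Import all_boot all_algebra.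

Set Implicit Arguments.
Unset Strict Implicit.
Unset Printing Implicit Defensive.

(* The directed path on n vertices.  The vertices 1, ..., n are represented by
   the elements 0, ..., n - 1 of 'I_n. *)
Definition dipath (n : nat) : rel 'I_n := fun u v => v == u.+1 :> nat.

Section WeakEndomorphisms.

Variables (V : finType) (E : rel V).

Definition weak_endo (f : {ffun V -> V}) : bool :=
  [forall u, forall v, E u v && (f u != f v) ==> E (f u) (f v)].

Record wEnd := WEnd { wEnd_fun :> {ffun V -> V}; _ : weak_endo wEnd_fun }.

HB.instance Definition _ := [isSub for wEnd_fun].
HB.instance Definition _ := [Finite of wEnd by <:].

Lemma weak_endoP (f : {ffun V -> V}) :
  reflect (forall u v, E u v -> f u <> f v -> E (f u) (f v)) (weak_endo f).
Proof.
apply: (iffP forallP) => [H u v Euv /eqP nfuv | H u].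
  by move/forallP/(_ v)/implyP: (H u); apply; rewrite Euv.
by apply/forallP=> v; apply/implyP=> /andP[Euv /eqP]; apply: H.
Qed.

Lemma wEnd_one_subproof : weak_endo [ffun x => x].
Proof. by apply/weak_endoP => u v Euv _; rewrite !ffunE. Qed.

Definition wEnd_one : wEnd := WEnd wEnd_one_subproof.

(* Maps act on the right: x (a b) = (x a) b. *)
Lemma wEnd_mul_subproof (a b : wEnd) : weak_endo [ffun x => b (a x)].
Proof.
case: a b => [a /weak_endoP aE] [b /weak_endoP bE] /=.
apply/weak_endoP => u v Euv; rewrite !ffunE => nab.
by apply: (bE _ _ _ nab); apply: aE => // eqa; apply: nab; rewrite eqa.
Qed.

Definition wEnd_mul (a b : wEnd) : wEnd := WEnd (wEnd_mul_subproof a b).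

Lemma wEnd_mulA : associative wEnd_mul.
Proof. by move=> a b c; apply/val_inj/ffunP => x; rewrite /= !ffunE. Qed.

Lemma wEnd_mul1g : left_id wEnd_one wEnd_mul.
Proof. by move=> a; apply/val_inj/ffunP => x; rewrite !ffunE. Qed.

Lemma wEnd_mulg1 : right_id wEnd_one wEnd_mul.
Proof. by move=> a; apply/val_inj/ffunP => x; rewrite !ffunE. Qed.

HB.instance Definition _ := isMonoid.Build wEnd wEnd_mulA wEnd_mul1g wEnd_mulg1.

End WeakEndomorphisms.

(* Main.v *)
Require Import Defs.
From mathcomp Require Import all_boot all_algebra.
From mathcomp Require Import zify ring.

(** Along the path, one step to the right moves the image of a weak endomorphism
    by 0 or 1, so a weak endomorphism is exactly a nondecreasing 1-Lipschitz map.
    Let [a] be idempotent, with values [i] and [j] at the two ends of the path.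
    Then [a] fixes [i] and [j].  Monotonicity makes [a] constant on the vertices
    up to [i] and on those from [j] on; between them, moving from [i] to [j] in
    [j - i] steps of length at most 1 leaves no choice but the identity.  So [a]
    is the clamping map onto the interval [[i, j]] (lemma [idem_clamp]).
    Conversely every clamping map is an idempotent weak endomorphism, and it
    determines its interval by its values at the two ends.  The idempotents
    are therefore counted by the pairs [i <= j] of vertices. *)

Set Implicit Arguments.
Unset Strict Implicit.
Unset Printing Implicit Defensive.

Lemma wEnd_idemP (V : finType) (E : rel V) (a : wEnd E) :
  reflect (forall x, a (a x) = a x) (a ^+ 2 == a)%g.
Proof.
apply: (iffP eqP) => [aa x | aa].
  by have := congr1 (fun b : wEnd E => b x) aa; rewrite /= ffunE.
by apply/val_inj/ffunP => x; rewrite /= ffunE aa.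
Qed.

Lemma wEnd_dipath_step n (a : wEnd (@dipath n)) (u v : 'I_n) :
  v = u.+1 :> nat -> a u <= a v <= (a u).+1.
Proof.
case: a => f /= /weak_endoP fE uv.
have [->|/eqP ne] := eqVneq (f u) (f v); first by rewrite leqnn leqnSn.
have /eqP -> : dipath (f u) (f v) by apply: fE => //; apply/eqP.
by rewrite leqnSn leqnn.
Qed.

Lemma wEnd_dipath_lip n (a : wEnd (@dipath n)) (u v : 'I_n) :
  u <= v -> a u <= a v <= a u + (v - u).
Proof.
case: v => v /=; elim: v => [|v IHv] ltvn leuv.
  have -> : u = Ordinal ltvn by apply: val_inj => /=; lia.
  by rewrite /= leqnn leq_addr.
have [equ|neu] := eqVneq (u : nat) v.+1.
  have -> : u = Ordinal ltvn by apply: val_inj.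
  by rewrite leqnn leq_addr.
have ltvn' : v < n by lia.
have := IHv ltvn' ltac:(lia).
have := @wEnd_dipath_step n a (Ordinal ltvn') (Ordinal ltvn) erefl.
move: (a u) (a (Ordinal ltvn')) (a (Ordinal ltvn)) => au av' av.
lia.
Qed.

Section Clamp.

Variable m : nat.
Implicit Types i j x : 'I_m.+1.

(** When [j < i] this is the constant map [i]: the formula is a weak
    endomorphism for all [i] and [j], but determines [(i, j)] only on the pairs
    with [i <= j]. *)
Definition clamp_fun i j : {ffun 'I_m.+1 -> 'I_m.+1} :=
  [ffun x : 'I_m.+1 => inord (maxn i (minn x j))].

Lemma clamp_funE i j x : clamp_fun i j x = maxn i (minn x j) :> nat.
Proof. by rewrite ffunE inordK //; have := ltn_ord i; have := ltn_ord j; lia. Qed.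

Lemma clamp_subproof i j : weak_endo (@dipath m.+1) (clamp_fun i j).
Proof.
apply/weak_endoP => u v /eqP uv ne; apply/eqP.
have {}ne : clamp_fun i j u <> clamp_fun i j v :> nat by move/val_inj.
by move: ne; rewrite !clamp_funE; lia.
Qed.

Definition clamp i j : wEnd (@dipath m.+1) := WEnd (clamp_subproof i j).

Lemma clampE i j x : clamp i j x = maxn i (minn x j) :> nat.
Proof. exact: clamp_funE. Qed.

Lemma clamp_idem i j : (clamp i j ^+ 2 == clamp i j)%g.
Proof. by apply/wEnd_idemP => x; apply: val_inj; rewrite /= !clampE; lia. Qed.

(** On [[i, j]] the Lipschitz bound is used twice: from the fixed point [i] it
    gives [a x <= x], and towards the fixed point [j] it gives [x <= a x]. *)
Lemma idem_clamp (a : wEnd (@dipath m.+1)) :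
  (a ^+ 2 == a)%g -> a = clamp (a ord0) (a ord_max).
Proof.
move/wEnd_idemP=> aa; apply/val_inj/ffunP => x; apply: val_inj.
rewrite /= clampE.
have := aa ord0; have := aa ord_max.
move: (a ord0) (a ord_max) (wEnd_dipath_lip a (leq0n x : ord0 <= x))
  (wEnd_dipath_lip a (leq_ord x : x <= ord_max)) => i j lip0 lipm aj ai.
have := @wEnd_dipath_lip _ a i x; have := @wEnd_dipath_lip _ a x i.
have := @wEnd_dipath_lip _ a j x; have := @wEnd_dipath_lip _ a x j.
rewrite ai aj.
move: (a x : nat) (i : nat) (j : nat) (x : nat) (leq_ord x) lip0 lipm.
by move=> ax ni nj nx /=; lia.
Qed.

Lemma clamp_inj :
  {in [set p : 'I_m.+1 * 'I_m.+1 | p.1 <= p.2] &,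
    injective (fun p => clamp p.1 p.2)}.
Proof.
move=> [i j] [k l]; rewrite !inE /= => leij lekl eqc.
have val_at x : maxn i (minn x j) = maxn k (minn x l) by rewrite -!clampE eqc.
have := val_at ord0; have := val_at ord_max; rewrite /= => at_max at_0.
have := leq_ord j; have := leq_ord l => lelm lejm.
by congr pair; apply: val_inj => /=; lia.
Qed.

Lemma idem_clamp_image :
  [set a : wEnd (@dipath m.+1) | (a ^+ 2 == a)%g]
    = [set clamp p.1 p.2 | p in [set p : 'I_m.+1 * 'I_m.+1 | p.1 <= p.2]].
Proof.
apply/setP => a; rewrite inE; apply/idP/imsetP => [aa | [p _ ->]].
  exists (a ord0, a ord_max); last exact: idem_clamp.
  by rewrite inE; case/andP: (wEnd_dipath_lip a (leq0n m : ord0 <= ord_max)).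
exact: clamp_idem.
Qed.

End Clamp.

Lemma card_ord_le_pairs n :
  #|[set p : 'I_n * 'I_n | p.1 <= p.2]| = 'C(n.+1, 2).
Proof.
rewrite -bin2_sum big_mkord big_ord_recl add0n -sum1dep_card.
rewrite -(pair_big_dep xpredT (fun i j : 'I_n => i <= j) (fun _ _ => 1)) /=.
rewrite (exchange_big_dep xpredT) //=; apply: eq_bigr => j _.
(* The first coordinates below [j] are the first [j + 1] elements of ['I_n]. *)
rewrite -(big_ord_widen n (fun=> 1) (ltn_ord j : j.+1 <= n)).
by rewrite sum1_card card_ord.
Qed.

Local Open Scope ring_scope.

Theorem corollary1p9 (n : nat) (hn : (0 < n)%N) :
  #|[set a : wEnd (@dipath n) | (a ^+ 2 == a)%g]|%:R
    = 1 / 2 * (n%:R + n%:R ^+ 2) :> rat.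
Proof.
case: n hn => // m _; rewrite idem_clamp_image card_in_imset; last exact: clamp_inj.
rewrite card_ord_le_pairs.
have : (2 * 'C(m.+2, 2) = m.+1 + m.+1 ^ 2)%N.
  by rewrite -mul_bin_diag bin1 /=; lia.
move/(congr1 (fun k : nat => k%:R : rat)); rewrite GRing.natrM GRing.natrD GRing.natrX => <-.
by field.
Qed.
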